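(* Let $m$ be a positive integer and $q\neq 2$ a prime power. There exist three distinct $\mathbb{F}_q$-sublines $\mathfrak{b}_1,\mathfrak{b}_2,\mathfrak{b}_3$ of $\mathrm{PG}(1,q^m)$ such that $|\mathfrak{b}_i\cap\mathfrak{b}_j|=2$ for all $i\neq j$ and $\mathfrak{b}_1\cap\mathfrak{b}_2\cap\mathfrak{b}_3=\emptyset$ if and only if $m$ is even.
   Context: An $\mathbb{F}_q$-subline of $\mathrm{PG}(1,q^m)$ is a point set projectively equivalent (under $\mathrm{PGL}(2,q^m)$) to the canonical subline $\{\langle(x,y)\rangle_{\mathbb{F}_{q^m}} : (x,y)\in\mathbb{F}_q^2\setminus\{0\}\}\cong\mathrm{PG}(1,q)$. *)

(* Defs.v *)
From HB Require Import structures.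
From mathcomp Require Import all_boot all_order all_algebra all_fingroup.

Set Implicit Arguments.
Unset Strict Implicit.
Unset Printing Implicit Defensive.

Import GRing.Theory.
Local Open Scope ring_scope.

(* The library only makes {vspace vT} a choiceType; over a finite field it is *)
(* a finType, so that {set {vspace vT}} and cardinals of such sets are        *)
(* available.                                                                 *)
Module VspaceFinite.
Import VectorInternalTheory.
#[export] HB.instance Definition _ (K : finFieldType) (vT : vectType K) :=
  [Countable of {vspace vT} by <:].
#[export] HB.instance Definition _ (K : finFieldType) (vT : vectType K) :=
  [Finite of {vspace vT} by <:].
Module Exports. HB.reexport. End Exports.
End VspaceFinite.
Export VspaceFinite.Exports.

(* A point of PG(1, K) is a 1-dimensional K-subspace of K^2; a point set is a *)
(* set of vector subspaces contained in PG1 K.                                *)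
Definition PG1 (K : finFieldType) : {set {vspace 'rV[K]_2}} :=
  [set U | \dim U == 1%N].

Definition row2 (K : finFieldType) (x y : K) : 'rV[K]_2 :=
  \row_(i < 2) if i == 0 then x else y.

(* F_q enters as a field F together with an embedding iota of F into K.       *)
Definition canonical_subline (F K : finFieldType) (iota : {rmorphism F -> K}) :
    {set {vspace 'rV[K]_2}} :=
  [set <[row2 (iota u.1) (iota u.2)]>%VS | u : F * F & u != (0, 0)].

(* PGL(2, K) is GL(2, K) modulo scalar matrices, and scalar matrices fix      *)
(* every subspace: ranging over GL(2, K) gives exactly the projectivities.    *)
Definition projective_image (K : finFieldType) (g : {'GL_2[K]})
    (S : {set {vspace 'rV[K]_2}}) : {set {vspace 'rV[K]_2}} :=
  [set (linfun (mulmxr (GLval g)) @: U)%VS | U in S].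

Definition projectively_equivalent (K : finFieldType)
    (S T : {set {vspace 'rV[K]_2}}) : Prop :=
  exists g : {'GL_2[K]}, T = projective_image g S.

Definition is_subline (F K : finFieldType) (iota : {rmorphism F -> K})
    (b : {set {vspace 'rV[K]_2}}) : Prop :=
  b \subset PG1 K /\ projectively_equivalent (canonical_subline iota) b.

(* Main.v *)
(* In coordinates where b1 and b2 meet in 0 and oo, and b1 contains 1, the second
   point of b1 on b3 is some a in F_q, and b2 meets b3 in t and b * t with b in
   F_q and t outside F_q.  Four points lie on a common subline iff their
   cross-ratio is in F_q; applied to 1, a, t, b * t in b3 this yields a quadratic
   equation for t over F_q with nonzero leading coefficient.  Hence t generates
   F_(q^2) inside F_(q^m), and m is even.  Conversely, if m is even, take t in
   F_(q^2) outside F_q, with norm n and b chosen so that b is not 0 or 1 and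
   b * n is not 1, and put a = b * n. *)

Require Import Defs.
From HB Require Import structures.
From mathcomp Require Import all_boot all_order all_algebra all_fingroup.
From mathcomp Require Import finfield ring.

Set Implicit Arguments.
Unset Strict Implicit.
Unset Printing Implicit Defensive.

Import GRing.Theory.
Local Open Scope ring_scope.

(** * Quadratic elements of finite field extensions *)

(** Over F, ['X^q - 'X] splits as the product of all ['X - x]; mapped through [iota], its roots in K
    are therefore images of elements of F. *)
Lemma expf_card_fixed (F K : finFieldType) (iota : {rmorphism F -> K}) (y : K) :
  y ^+ #|F| = y -> exists x, y = iota x.
Proof.
move=> yq.
have : root (map_poly iota ('X^#|F| - 'X)) y.
  by rewrite rmorphB /= map_polyXn map_polyX /root !hornerE yq subrr.
rewrite finField_genPoly rmorph_prod /root horner_prod => /eqP/eqP.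
rewrite prodf_seq_eq0 => /hasP [x _ /=].
rewrite rmorphB /= map_polyX map_polyC /= !hornerE subr_eq0 => /eqP ->.
by exists x.
Qed.

(** [#|F|] is a power of the characteristic, which [iota] carries over to K, so this map is an
    iterated Frobenius. *)
Lemma expf_cardD (F K : finFieldType) (iota : {rmorphism F -> K}) (x y : K) :
  (x + y) ^+ #|F| = x ^+ #|F| + y ^+ #|F|.
Proof.
have [p p_pr pF] := finPcharP F.
have pK : p \in [pchar K] by rewrite (fmorph_pchar iota).
rewrite exprDn_pchar //.
have := card_pprimeChar pF; rewrite /= => ->.
by rewrite (eq_pnat _ (pcharf_eq pK)) pnatX pnat_id.
Qed.

Lemma rmorph_expf_card (F K : finFieldType) (iota : {rmorphism F -> K}) (x : F) :
  iota x ^+ #|F| = iota x.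
Proof. by rewrite -rmorphXn /= expf_card. Qed.

Lemma expf_card_inj (F K : finFieldType) (iota : {rmorphism F -> K}) :
  injective (fun x : K => x ^+ #|F|).
Proof.
move=> x y /= exy; apply/eqP; rewrite -subr_eq0.
have cF0 : (0 < #|F|)%N by apply/card_gt0P; exists 0.
have : (x - y) ^+ #|F| == 0.
  have := expf_cardD iota (x - y) y; rewrite subrK exy => /eqP.
  by rewrite -subr_eq subrr eq_sym.
by rewrite expf_eq0 cF0.
Qed.

(* The conjugate t^q is the second root, so t^(q^2) = t, while t^(q^m) = t. *)
Lemma quadratic_even_degree (F K : finFieldType) (iota : {rmorphism F -> K})
    (m : nat) (t : K) (a b c : F) :
    #|K| = (#|F| ^ m)%N -> a != 0 ->
    iota a * t ^+ 2 + iota b * t + iota c = 0 ->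
    (forall x, t <> iota x) -> ~~ odd m.
Proof.
move=> cK a0 quad tF; apply/negP => m_odd.
set q := #|F| in cK.
have tq : t ^+ q != t.
  by apply/eqP => /(@expf_card_fixed F K iota _) [x tx]; apply: (tF x).
have ia0 : iota a != 0 by rewrite fmorph_eq0.
have frob (u : K) : iota a * u ^+ 2 + iota b * u + iota c = 0 ->
    iota a * (u ^+ q) ^+ 2 + iota b * u ^+ q + iota c = 0.
  move=> /(congr1 (fun z => z ^+ q)).
  rewrite !(expf_cardD iota) !exprMn !(rmorph_expf_card iota) => uq.
  by rewrite [_ ^+ 2]expr2 uq expr0n gtn_eqF // ltnW // finNzRing_gt1.
have other u : iota a * u ^+ 2 + iota b * u + iota c = 0 -> u = t \/
    iota a * (u + t) + iota b = 0.
  move=> uq; have : (u - t) * (iota a * (u + t) + iota b) == 0.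
    rewrite -[X in _ == X](subrr 0) -{1}uq -quad; apply/eqP; ring.
  by rewrite mulf_eq0 subr_eq0 => /orP [/eqP|/eqP]; [left|right].
have [|tq1] := other _ (frob _ quad); first by move/eqP; rewrite (negPf tq).
(* Otherwise t^(q^2) and t^q both equal the root other than t, and injectivity of the q-th power
   gives t^q = t. *)
have tq2 : (t ^+ q) ^+ q = t.
  have [//|tq2] := other _ (frob _ (frob _ quad)).
  case/eqP: tq; apply: (expf_card_inj iota) => /=.
  apply: (addIr t); apply: (mulfI ia0); apply: (addIr (iota b)).
  by rewrite tq2.
have even_iter k : t ^+ (q ^ k.*2) = t.
  elim: k => [|k IHk]; first by rewrite expn0 expr1.
  by rewrite doubleS 2!expnSr 2!exprM IHk tq2.
case/eqP: tq; rewrite -[RHS]expf_card cK -(odd_double_half m) m_odd.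
by rewrite expnD expn1 mulnC exprM even_iter.
Qed.

(** ['X^k - 1] has at most k roots, fewer than the number of nonzero elements of K. *)
Lemma unity_root_escape (K : finFieldType) (k : nat) :
  (0 < k)%N -> (k < #|K|.-1)%N -> exists2 y : K, y != 0 & y ^+ k != 1.
Proof.
move=> k0 kK.
have [/forallP all1|/forallPn /= [y]] :=
  boolP [forall y : K, (y != 0) ==> (y ^+ k == 1)]; last first.
  by rewrite negb_imply => /andP []; exists y.
have := @max_poly_roots K ('X^k - 1%:P) [seq y <- enum K | y != 0].
rewrite filter_uniq ?enum_uniq // size_XnsubC //.
have -> : 'X^k - 1%:P != 0 :> {poly K} by rewrite -size_poly_eq0 size_XnsubC.
have -> : all (root ('X^k - 1%:P)) [seq y <- enum K | y != 0].
  apply/allP => y; rewrite mem_filter => /andP [y0 _].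
  by rewrite /root !hornerE subr_eq0 (implyP (all1 y)).
rewrite size_filter; move=> /(_ isT isT isT).
have -> : count (fun y : K => y != 0) (enum K) = #|K|.-1.
  rewrite -(cardC1 (0 : K)) cardE -size_filter /enum_mem -filter_predI.
  by congr size; apply: eq_filter => y; rewrite !inE andbT.
by rewrite ltnS leqNgt kK.
Qed.

(** With e = (q^m - 1) / (q^2 - 1), any power t = y^e of a nonzero y satisfies t^(q^2 - 1) = 1, and
    y is chosen so that t^(q - 1) is not 1. The trace s = t + t^q and the norm n = t t^q are fixed
    by the q-th power, hence lie in F. *)
Lemma exists_quadratic (F K : finFieldType) (iota : {rmorphism F -> K})
    (m : nat) : #|K| = (#|F| ^ m)%N -> (0 < m)%N -> ~~ odd m ->
  exists t s n, t ^+ 2 = iota s * t - iota n /\ (forall x, t <> iota x).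
Proof.
move=> cK m0 m_even; set q := #|F| in cK.
have q1 : (1 < q)%N by apply: finNzRing_gt1.
have [e qm] : exists e, (q ^ m).-1 = (e * (q ^ 2).-1)%N.
  apply/dvdnP; rewrite -(even_halfK m_even) -mul2n expnM.
  by rewrite [in X in (_ %| X)%N]predn_exp dvdn_mulr.
have Km0 : (0 < (q ^ m).-1)%N.
  by rewrite -subn1 subn_gt0 -(expn0 q) ltn_exp2l.
have e0 : (0 < e)%N by move: Km0; rewrite qm muln_gt0 => /andP [].
have q2 : (q ^ 2).-1 = (q.-1 * q.+1)%N.
  by rewrite predn_exp !big_ord_recl big_ord0 expn0 expn1 addn0.
have qp0 : (0 < q.-1)%N by rewrite -subn1 subn_gt0.
(* The bound holds because e (q - 1) < e (q - 1) (q + 1) = q^m - 1. *)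
have [|| y y0 ye] := @unity_root_escape K (e * q.-1).
- by rewrite muln_gt0 e0 qp0.
- by rewrite cK qm q2 ltn_pmul2l // ltn_Pmulr // ltnS ltnW.
pose t := y ^+ e.
have t0 : t != 0 by rewrite expf_neq0.
have tq : t ^+ q != t.
  rewrite -(prednK (ltnW q1)) exprSr -[X in _ != X]mul1r.
  by rewrite (inj_eq (mulIf t0)) -exprM.
have tqq : (t ^+ q) ^+ q = t.
  rewrite -exprM -(prednK (_ : 0 < q * q)%N) ?muln_gt0 ?(ltnW q1) //.
  rewrite exprSr mulnn -exprM -qm -cK.
  suff -> : y ^+ #|K|.-1 = 1 by rewrite mul1r.
  by apply: (mulIf y0); rewrite mul1r -exprSr prednK ?expf_card // ltnW // finNzRing_gt1.
have [s st] : exists s, t + t ^+ q = iota s.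
  by apply: expf_card_fixed; rewrite (expf_cardD iota) tqq addrC.
have [n nt] : exists n, t * t ^+ q = iota n.
  by apply: expf_card_fixed; rewrite exprMn tqq mulrC.
exists t, s, n; split; first by rewrite -st -nt; ring.
by move=> x tx; case/eqP: tq; rewrite tx rmorph_expf_card.
Qed.

(* The norm of t + x is a monic quadratic polynomial in x, so among
   three or more values of x one avoids 1 / b. *)
Lemma exists_quadratic_norm (F K : finFieldType) (iota : {rmorphism F -> K})
    (m : nat) (b : F) : #|K| = (#|F| ^ m)%N -> (0 < m)%N -> ~~ odd m ->
    (2 < #|F|)%N -> b != 0 ->
  exists t s n, [/\ t ^+ 2 = iota s * t - iota n, b * n != 1
                  & forall x, t <> iota x].
Proof.
move=> cK m0 m_even F2 b0.
have [t [s [n [quad tF]]]] := @exists_quadratic F K iota m cK m0 m_even.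
(* The value of [N] at x is the norm of t + x minus 1 / b. *)
pose N := 'X^2 + (s *: 'X + (n - b^-1)%:P) : {poly F}.
have sN : size N = 3%N.
  rewrite size_polyDl size_polyXn // ltnS (leq_trans (size_polyD _ _)) //.
  by rewrite geq_max (leq_trans (size_scale_leq _ _)) ?size_polyX //
             (leq_trans (size_polyC_leq1 _)).
have [x Nx] : exists x, N.[x] != 0.
  apply/existsP; apply: contraLR F2; rewrite negb_exists => /forallP all0.
  rewrite -leqNgt -ltnS -sN cardE max_poly_roots ?enum_uniq //.
    by rewrite -size_poly_eq0 sN.
  by apply/allP => x _; have := all0 x; rewrite negbK.
exists (t + iota x), (s + x *+ 2), (n + s * x + x ^+ 2); split.
- rewrite !(rmorphD, rmorphM, rmorphMn, rmorphXn) /= sqrrD quad; ring.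
- apply: contra Nx => /eqP bn.
  have -> : N.[x] = n + s * x + x ^+ 2 - b^-1 by rewrite /N !hornerE /=; ring.
  by rewrite subr_eq0 -[_ + _](mulKf b0) bn mulr1.
- by move=> y ty; apply: (tF (y - x)); rewrite rmorphB -ty addrK.
Qed.

(** * Frames of a subline *)

Definition det2 (K : fieldType) (v w : 'rV[K]_2) : K :=
  v 0 0 * w 0 1 - v 0 1 * w 0 0.

Lemma det2_comb (K : fieldType) (e f : 'rV[K]_2) (x y z w : K) :
  det2 (x *: e + y *: f) (z *: e + w *: f) = (x * w - y * z) * det2 e f.
Proof. by rewrite /det2 !mxE; ring. Qed.

Lemma det2Z (K : fieldType) (v w : 'rV[K]_2) (x y : K) :
  det2 (x *: v) (y *: w) = x * y * det2 v w.
Proof. by rewrite /det2 !mxE; ring. Qed.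

Lemma rV2P (K : fieldType) (v w : 'rV[K]_2) :
  v 0 0 = w 0 0 -> v 0 1 = w 0 1 -> v = w.
Proof.
move=> e0 e1; apply/rowP => i.
by case: (unliftP 0 i) => [j|] ->; rewrite ?e0 // ord1 (_ : lift 0 0 = 1) //;
   apply: val_inj.
Qed.

Lemma det2_neq0 (K : fieldType) (e f : 'rV[K]_2) :
  det2 e f != 0 -> e != 0 /\ f != 0.
Proof.
by move=> d; split; apply: contraNneq d => ->; rewrite /det2 !mxE; apply/eqP; ring.
Qed.

Lemma comb_eq0 (K : fieldType) (e f : 'rV[K]_2) (x y : K) : det2 e f != 0 ->
  (x *: e + y *: f == 0) = (x == 0) && (y == 0).
Proof.
move=> d; apply/eqP/andP => [v0|[/eqP -> /eqP ->]]; last by rewrite !scale0r addr0.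
have := det2_comb e f x y 0 1; have := det2_comb e f x y 1 0.
rewrite v0 !(mulr0, mulr1, subr0, sub0r) {1 3}/det2 !mxE !mul0r subrr.
move=> /esym/eqP; rewrite mulf_eq0 (negPf d) orbF oppr_eq0 => ->.
by move=> /esym/eqP; rewrite mulf_eq0 (negPf d) orbF => ->.
Qed.

Lemma eq_vline_det2 (K : fieldType) (v w : 'rV[K]_2) : v != 0 -> w != 0 ->
  (<[v]>%VS == <[w]>%VS) = (det2 v w == 0).
Proof.
move=> v0 w0; apply/eqP/eqP => [vw|d0].
  have /vlineP [k ->] : v \in <[w]>%VS by rewrite -vw memv_line.
  by rewrite /det2 !mxE; ring.
apply/eqP; rewrite eqEdim !dim_vline v0 w0 andbT -memvE; apply/vlineP.
have [w00|w00] := eqVneq (w 0 0) 0.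
  have w01 : w 0 1 != 0.
    by apply: contraNneq w0 => w01; apply/eqP/rV2P; rewrite mxE.
  exists (v 0 1 / w 0 1); apply: rV2P; rewrite mxE ?divfK //.
  apply: (mulIf w01); rewrite w00 mulr0 mul0r.
  by move: d0; rewrite /det2 w00 mulr0 subr0.
exists (v 0 0 / w 0 0); apply: rV2P; rewrite mxE ?divfK //.
by apply: (mulIf w00); rewrite mulrAC divfK //; apply/esym/subr0_eq.
Qed.

(** Homogeneous coordinates (x : y) in the basis [e], [f]. The affine coordinate is y / x, so 0 is
    [point e f 1 0] and oo is [point e f 0 1]. *)
Definition point (K : fieldType) (e f : 'rV[K]_2) (x y : K) : {vspace 'rV[K]_2} :=
  <[x *: e + y *: f]>%VS.

Lemma eq_point (K : fieldType) (e f : 'rV[K]_2) (x y z w : K) :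
    det2 e f != 0 -> (x != 0) || (y != 0) -> (z != 0) || (w != 0) ->
  (point e f x y == point e f z w) = (x * w == y * z).
Proof.
move=> d xy zw; rewrite eq_vline_det2 ?comb_eq0 -?negb_and ?negbK //;
  try by rewrite negb_and.
by rewrite det2_comb mulf_eq0 (negPf d) orbF subr_eq0.
Qed.

Lemma pointZ (K : fieldType) (e f : 'rV[K]_2) (k x y : K) : k != 0 ->
  point e f (k * x) (k * y) = point e f x y.
Proof.
move=> k0; apply/eqP; rewrite /point -!scalerA -scalerDr.
set v := _ + _.
rewrite eqEsubv -!memvE rpredZ ?memv_line //=; apply/vlineP; exists k^-1.
by rewrite scalerK.
Qed.

(** For a basis [e], [f], this is the image of the canonical subline under the projectivity whose
    matrix has rows [e] and [f]. *)
Definition frame_subline (F K : finFieldType) (iota : {rmorphism F -> K})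
    (e f : 'rV[K]_2) : {set {vspace 'rV[K]_2}} :=
  [set point e f (iota u.1) (iota u.2) | u : F * F & u != (0, 0)].

Lemma frame_sublineP (F K : finFieldType) (iota : {rmorphism F -> K})
    (e f : 'rV[K]_2) (P : {vspace 'rV[K]_2}) :
  reflect (exists x y, (x != 0) || (y != 0) /\ P = point e f (iota x) (iota y))
          (P \in frame_subline iota e f).
Proof.
apply: (iffP imsetP) => [[[x y]]|[x [y [xy ->]]]].
  by rewrite inE xpair_eqE negb_and => xy ->; exists x, y.
by exists (x, y); rewrite // inE xpair_eqE negb_and.
Qed.

Lemma affine_point_mem (F K : finFieldType) (iota : {rmorphism F -> K})
    (e f : 'rV[K]_2) (t : K) : det2 e f != 0 ->
  point e f 1 t \in frame_subline iota e f -> exists x, t = iota x.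
Proof.
move=> d /frame_sublineP [x [y [xy /eqP]]].
rewrite eq_point ?oner_eq0 ?fmorph_eq0 // mul1r => /eqP yx.
have x0 : x != 0.
  by apply: contraTneq xy => x0; move: yx; rewrite x0 rmorph0 mulr0 eqxx => /eqP;
     rewrite fmorph_eq0 => ->.
by exists (y / x); rewrite fmorph_div yx mulfK // fmorph_eq0.
Qed.

Lemma row2_comb (K : finFieldType) (g : 'M[K]_2) (x y : K) :
  row2 x y *m g = x *: row 0 g + y *: row 1 g.
Proof.
apply/rowP => i; rewrite !mxE !big_ord_recl big_ord0 !mxE /= addr0.
by rewrite (_ : lift 0 0 = 1) //; apply: val_inj.
Qed.

Lemma det_mx2 (K : finFieldType) (g : 'M[K]_2) : \det g = det2 (row 0 g) (row 1 g).
Proof.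
rewrite (expand_det_row _ 0) !big_ord_recl big_ord0 /cofactor !det_mx11 !mxE /=.
rewrite /det2 !mxE addr0 expr0 mul1r /bump /= expr1 mulN1r mulrN.
by congr (_ * g _ _ - g _ _ * g _ _); apply: val_inj.
Qed.

Lemma projective_image_canonical (F K : finFieldType)
    (iota : {rmorphism F -> K}) (g : {'GL_2[K]}) :
  projective_image g (canonical_subline iota) =
  frame_subline iota (row 0 (GLval g)) (row 1 (GLval g)).
Proof.
rewrite /projective_image /canonical_subline -imset_comp; apply: eq_imset => u /=.
by rewrite limg_line lfunE /= row2_comb.
Qed.

Lemma is_sublineP (F K : finFieldType) (iota : {rmorphism F -> K})
    (b : {set {vspace 'rV[K]_2}}) :
  is_subline iota b <-> exists e f, det2 e f != 0 /\ b = frame_subline iota e f.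
Proof.
split=> [[_ [g ->]]|[e [f [d ->]]]].
  exists (row 0 (GLval g)), (row 1 (GLval g)).
  rewrite projective_image_canonical -det_mx2 -unitfE -unitmxE; split; last by [].
  exact: (valP g).
split.
  apply/subsetP => P /frame_sublineP [x [y [xy ->]]].
  by rewrite inE dim_vline comb_eq0 // !fmorph_eq0 negb_and xy.
pose g : 'M[K]_2 := \matrix_(i < 2) (if i == 0 then e else f).
have r0 : row 0 g = e by rewrite rowK.
have r1 : row 1 g = f by rewrite rowK.
have ug : g \is a GRing.unit.
  by rewrite -[_ \is a _]/(g \in unitmx) unitmxE unitfE det_mx2 r0 r1.
by exists (FinRing.Unit ug); rewrite projective_image_canonical /= r0 r1.
Qed.

(** * Change of frame and the subline through three points *)

Lemma frame_subline_rebase_sub (F K : finFieldType) (iota : {rmorphism F -> K})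
    (e f : 'rV[K]_2) (k : K) (a b c d : F) : k != 0 -> a * d - b * c != 0 ->
  frame_subline iota (k *: (iota a *: e + iota b *: f)) (k *: (iota c *: e + iota d *: f))
    \subset frame_subline iota e f.
Proof.
move=> k0 D; apply/subsetP => P /frame_sublineP [x [y [xy ->]]].
apply/frame_sublineP; exists (x * a + y * c), (x * b + y * d); split.
  apply: contraTT xy; rewrite negb_or !negbK => /andP [/eqP h1 /eqP h2].
  (* Multiplying by the determinant recovers x and y from the new coordinates through the adjugate
     matrix. *)
  rewrite negb_or !negbK -(mulIr_eq0 x (mulIf D)) -(mulIr_eq0 y (mulIf D)).
  have -> : x * (a * d - b * c) = d * (x * a + y * c) - c * (x * b + y * d) by ring.
  have -> : y * (a * d - b * c) = a * (x * b + y * d) - b * (x * a + y * c) by ring.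
  by rewrite h1 h2 !mulr0 subr0 eqxx.
rewrite -[RHS](pointZ _ _ _ _ k0) /point; congr <[_]>%VS.
rewrite !(rmorphD, rmorphM) /=.
by apply/rowP => i; rewrite !mxE; ring.
Qed.

(** The inverse change of basis has the same form: the adjugate matrix over F with scalar (k D')^-1,
    so the inclusion applies both ways. *)
Lemma frame_subline_rebase (F K : finFieldType) (iota : {rmorphism F -> K})
    (e f : 'rV[K]_2) (k : K) (a b c d : F) : k != 0 -> a * d - b * c != 0 ->
  frame_subline iota (k *: (iota a *: e + iota b *: f)) (k *: (iota c *: e + iota d *: f))
    = frame_subline iota e f.
Proof.
move=> k0 D; apply/eqP; rewrite eqEsubset frame_subline_rebase_sub //=.
set D' := a * d - b * c in D.
set e' := k *: _; set f' := k *: (iota c *: _ + _).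
have iD : iota D' != 0 by rewrite fmorph_eq0.
have iDE : iota D' = iota a * iota d - iota b * iota c.
  by rewrite rmorphB !rmorphM.
have -> : e = (k * iota D')^-1 *: (iota d *: e' + iota (- b) *: f').
  apply: (canRL (scalerK _)); first by rewrite mulf_neq0.
  by rewrite rmorphN iDE; apply/rowP => i; rewrite !mxE; ring.
have -> : f = (k * iota D')^-1 *: (iota (- c) *: e' + iota a *: f').
  apply: (canRL (scalerK _)); first by rewrite mulf_neq0.
  by rewrite rmorphN iDE; apply/rowP => i; rewrite !mxE; ring.
apply: frame_subline_rebase_sub; first by rewrite invr_eq0 mulf_neq0.
by rewrite mulrNN mulrC.
Qed.

(** PGL(2,q) is transitive on triples of distinct points of a subline, so any such triple can serve
    as 0, oo, 1. *)
Lemma subline_frame (F K : finFieldType) (iota : {rmorphism F -> K})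
    (b : {set {vspace 'rV[K]_2}}) (P Q R : {vspace 'rV[K]_2}) :
    is_subline iota b -> P \in b -> Q \in b -> R \in b ->
    P != Q -> P != R -> Q != R ->
  exists e f, [/\ det2 e f != 0, P = point e f 1 0, Q = point e f 0 1,
                  R = point e f 1 1 & b = frame_subline iota e f].
Proof.
move=> /is_sublineP [e [f [d ->]]].
move=> /frame_sublineP [x1 [y1 [n1 ->]]] /frame_sublineP [x2 [y2 [n2 ->]]].
move=> /frame_sublineP [x3 [y3 [n3 ->]]].
rewrite !eq_point ?fmorph_eq0 // -!rmorphM !(inj_eq (fmorph_inj iota)) => h12 h13 h23.
have D : x1 * y2 - y1 * x2 != 0 by rewrite subr_eq0.
(* Cramer's rule: the third coordinate vector times x1 y2 - y1 x2 is [al] times the first plus [be]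
   times the second. Scaling by [al] and [be] makes R the unit point. *)
pose al := x3 * y2 - y3 * x2; pose be := x1 * y3 - y1 * x3.
have al0 : al != 0 by rewrite subr_eq0 mulrC [y3 * _]mulrC eq_sym.
have be0 : be != 0 by rewrite subr_eq0.
have ia0 : iota al != 0 by rewrite fmorph_eq0.
have ib0 : iota be != 0 by rewrite fmorph_eq0.
exists (iota (al * x1) *: e + iota (al * y1) *: f),
       (iota (be * x2) *: e + iota (be * y2) *: f); split.
- rewrite det2_comb -!rmorphM -rmorphB mulf_neq0 // fmorph_eq0.
  have -> : al * x1 * (be * y2) - al * y1 * (be * x2) =
    al * be * (x1 * y2 - y1 * x2) by ring.
  by rewrite !mulf_neq0.
- rewrite -[LHS](pointZ _ _ _ _ ia0) /point; congr <[_]>%VS.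
  by rewrite scale1r scale0r addr0 !rmorphM.
- rewrite -[LHS](pointZ _ _ _ _ ib0) /point; congr <[_]>%VS.
  by rewrite scale1r scale0r add0r !rmorphM.
- have iD : iota (x1 * y2 - y1 * x2) != 0 by rewrite fmorph_eq0.
  rewrite -[LHS](pointZ _ _ _ _ iD) /point; congr <[_]>%VS.
  rewrite !(rmorphM, rmorphB) /=.
  by apply/rowP => i; rewrite !mxE; ring.
- have := @frame_subline_rebase F K iota e f 1 (al * x1) (al * y1) (be * x2) (be * y2) (oner_neq0 _).
  rewrite !scale1r => -> //.
  have -> : al * x1 * (be * y2) - al * y1 * (be * x2) =
    al * be * (x1 * y2 - y1 * x2) by ring.
  by rewrite !mulf_neq0.
Qed.

Lemma point_rescale (K : fieldType) (e f e' f' : 'rV[K]_2) :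
    det2 e f != 0 -> det2 e' f' != 0 -> point e f 1 0 = point e' f' 1 0 ->
    point e f 0 1 = point e' f' 0 1 ->
  exists l m, [/\ l != 0, m != 0, e' = l *: e & f' = m *: f].
Proof.
move=> /det2_neq0 [e0 f0] /det2_neq0 [e0' f0'].
rewrite /point !scale1r !scale0r !addr0 !add0r => Ee Ef.
have /vlineP [l le] : e' \in <[e]>%VS by rewrite Ee memv_line.
have /vlineP [m mf] : f' \in <[f]>%VS by rewrite Ef memv_line.
exists l, m; split=> //.
  by apply: contraNneq e0' => l0; rewrite le l0 scale0r.
by apply: contraNneq f0' => m0; rewrite mf m0 scale0r.
Qed.

(** In frames adapted to P, Q, R, the common 0 and oo force a diagonal change of basis; the common
    unit point makes it scalar. *)
Lemma subline_eq3 (F K : finFieldType) (iota : {rmorphism F -> K})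
    (b b' : {set {vspace 'rV[K]_2}}) (P Q R : {vspace 'rV[K]_2}) :
    is_subline iota b -> is_subline iota b' ->
    P \in b :&: b' -> Q \in b :&: b' -> R \in b :&: b' ->
    P != Q -> P != R -> Q != R -> b = b'.
Proof.
move=> sb sb' /setIP [Pb Pb'] /setIP [Qb Qb'] /setIP [Rb Rb'] PQ PR QR.
have [e [f [d EP EQ ER ->]]] := subline_frame sb Pb Qb Rb PQ PR QR.
have [e' [f' [d' EP' EQ' ER' ->]]] := subline_frame sb' Pb' Qb' Rb' PQ PR QR.
have [|| l [m [l0 m0 Ee Ef]]] := point_rescale d d'; rewrite -?EP -?EQ //.
have : point e f 1 1 == point e f l m by rewrite -ER ER' /point Ee Ef !scale1r.
rewrite eq_point ?oner_eq0 ?l0 // !mul1r => /eqP ml.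
have := @frame_subline_rebase F K iota e f l 1 0 0 1 l0.
rewrite !rmorph1 !rmorph0 !scale1r !scale0r addr0 add0r Ee Ef ml => -> //.
by rewrite mulr1 mulr0 subr0 oner_eq0.
Qed.

Lemma sublineI (F K : finFieldType) (iota : {rmorphism F -> K})
    (b b' : {set {vspace 'rV[K]_2}}) (P Q : {vspace 'rV[K]_2}) :
    is_subline iota b -> is_subline iota b' -> b != b' -> P != Q ->
    P \in b :&: b' -> Q \in b :&: b' -> b :&: b' = [set P; Q].
Proof.
move=> sb sb' bb PQ Pi Qi; apply/eqP; rewrite eqEsubset; apply/andP; split; last first.
  by apply/subsetP => R; rewrite !inE => /orP [] /eqP ->; rewrite -in_setI.
apply/subsetP => R Ri; rewrite !inE; apply: contraNT bb.
rewrite negb_or => /andP [RP RQ]; apply/eqP.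
by apply: (subline_eq3 sb sb' Pi Qi Ri PQ); rewrite eq_sym.
Qed.

(** * Three sublines meeting pairwise in two points *)

Lemma point_cross (K : fieldType) (e f : 'rV[K]_2) (x y z w : K) :
  det2 e f != 0 -> point e f x y = point e f z w -> x * w = y * z.
Proof.
move=> d pq; apply/eqP; rewrite -subr_eq0 -(mulIr_eq0 _ (mulIf d)) -det2_comb.
have /vlineP [k ->] : x *: e + y *: f \in <[z *: e + w *: f]>%VS.
  by rewrite -/(point e f z w) -pq memv_line.
by rewrite /det2 !mxE; apply/eqP; ring.
Qed.

Lemma point_comb (K : fieldType) (e f : 'rV[K]_2) (k l a b c d x y : K) :
  point (k *: (a *: e + b *: f)) (l *: (c *: e + d *: f)) x y =
  point e f (x * k * a + y * l * c) (x * k * b + y * l * d).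
Proof.
by rewrite /point; congr <[_]>%VS; apply/rowP => i; rewrite !mxE; ring.
Qed.

Lemma mem_frame_subline_affine (F K : finFieldType) (iota : {rmorphism F -> K})
    (e f : 'rV[K]_2) (P : {vspace 'rV[K]_2}) : det2 e f != 0 ->
  P \in frame_subline iota e f -> P != point e f 0 1 ->
  exists a, P = point e f 1 (iota a).
Proof.
move=> d /frame_sublineP [x [y [xy ->]]].
rewrite eq_point ?oner_eq0 ?orbT ?fmorph_eq0 // mulr1 mulr0 fmorph_eq0 => x0.
have ix0 : iota x != 0 by rewrite fmorph_eq0.
exists (y / x).
by rewrite -[RHS](pointZ _ _ _ _ ix0) mulr1 -rmorphM mulrCA divff // mulr1.
Qed.

(** Frames of [b1], [b2], [b3] are adapted to (P, P', Q), (P, P', R) and (Q, Q', R). Writing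
    everything in the frame of [b1] and eliminating the scale factors of the third frame leaves the
    quadratic equation. *)
Lemma even_of_triangle (F K : finFieldType) (iota : {rmorphism F -> K}) (m : nat)
    (b1 b2 b3 : {set {vspace 'rV[K]_2}}) :
    #|K| = (#|F| ^ m)%N ->
    is_subline iota b1 -> is_subline iota b2 -> is_subline iota b3 ->
    #|b1 :&: b2| = 2%N -> #|b1 :&: b3| = 2%N -> #|b2 :&: b3| = 2%N ->
    b1 :&: b2 :&: b3 = set0 -> ~~ odd m.
Proof.
move=> cK s1 s2 s3 /eqP/cards2P [P [P' [PP' E12]]] /eqP/cards2P [Q [Q' [QQ' E13]]].
move=> /eqP/cards2P [R [R' [RR' E23]]] E0.
have [P1 P2] : P \in b1 /\ P \in b2 by apply/setIP; rewrite E12 !inE eqxx.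
have [P1' P2'] : P' \in b1 /\ P' \in b2 by apply/setIP; rewrite E12 !inE eqxx orbT.
have [Q1 Q3] : Q \in b1 /\ Q \in b3 by apply/setIP; rewrite E13 !inE eqxx.
have [Q1' Q3'] : Q' \in b1 /\ Q' \in b3 by apply/setIP; rewrite E13 !inE eqxx orbT.
have [R2 R3] : R \in b2 /\ R \in b3 by apply/setIP; rewrite E23 !inE eqxx.
have [R2' R3'] : R' \in b2 /\ R' \in b3 by apply/setIP; rewrite E23 !inE eqxx orbT.
have none X : X \in b1 -> X \in b2 -> X \in b3 -> False.
  by move=> X1 X2 X3; have := in_set0 X; rewrite -E0 !inE X1 X2 X3.
have neq12 X Y : X \in b1 -> X \in b2 -> Y \in b3 -> X != Y.
  by move=> X1 X2 Y3; apply/eqP => XY; apply: (none X); rewrite // XY.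
have [e [f [d EP EP' EQ Eb1]]] :=
  subline_frame s1 P1 P1' Q1 PP' (neq12 P Q P1 P2 Q3)
    (neq12 P' Q P1' P2' Q3).
have [a EQ'] : exists a, Q' = point e f 1 (iota a).
  by apply: (mem_frame_subline_affine (iota:=iota) d); rewrite -?Eb1 // -EP' eq_sym neq12.
have [e2 [f2 [d2 EP2 EP2' ER Eb2]]] :=
  subline_frame s2 P2 P2' R2 PP' (neq12 P R P1 P2 R3)
    (neq12 P' R P1' P2' R3).
have [b ER'] : exists b, R' = point e2 f2 1 (iota b).
  by apply: (mem_frame_subline_affine (iota:=iota) d2); rewrite -?Eb2 // -EP2' eq_sym neq12.
have [|| l [k [l0 k0 Ee2 Ef2]]] := point_rescale d d2; rewrite -?EP -?EP' //.
pose t := k / l.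
have kE : k = l * t by rewrite /t mulrC divfK.
have Rt : R = point e f 1 t.
  by rewrite ER -[RHS](pointZ _ _ _ _ l0) -kE mulr1 /point Ee2 Ef2 !scale1r.
have Rt' : R' = point e f 1 (iota b * t).
  rewrite ER' -[RHS](pointZ _ _ _ _ l0) mulrCA -kE mulr1 /point Ee2 Ef2 !scale1r.
  by rewrite scalerA.
have QR : Q != R by apply/eqP => QR; apply: (none Q); rewrite // QR.
have QR' : Q' != R by apply/eqP => QR'; apply: (none Q'); rewrite // QR'.
have [e3 [f3 [d3 EQ3 EQ3' ER3 Eb3]]] := subline_frame s3 Q3 Q3' R3 QQ' QR QR'.
(* Here c is the cross-ratio of Q, Q', R, R', with value 1 excluded by R' != R. *)
have [c ER3'] : exists c, R' = point e3 f3 1 (iota c).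
  apply: (mem_frame_subline_affine (iota:=iota) d3); rewrite -?Eb3 // -EQ3'.
  by apply/eqP => QR''; apply: (none Q'); rewrite // -QR''.
have c1 : 1 - c != 0.
  by rewrite subr_eq0; apply: contraNneq RR' => c1; rewrite ER3' -c1 rmorph1 ER3.
have a1 : iota a - 1 != 0.
  by rewrite subr_eq0; apply: contraNneq QQ' => a1; rewrite EQ EQ' a1.
have dq : det2 (1 *: e + 1 *: f) (1 *: e + iota a *: f) != 0.
  by rewrite det2_comb !mul1r mulf_neq0.
have [|| u [v [u0 v0 Ee3 Ef3]]] := point_rescale dq d3.
- by rewrite -EQ3 EQ /point !scale1r scale0r addr0.
- by rewrite -EQ3' EQ' /point !scale1r scale0r add0r.
(* Expressing R and R' through the scaled vectors at Q and Q' gives two relations, linear in the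
   scale factors u and v. *)
move: ER3 ER3'; rewrite Ee3 Ef3 !point_comb Rt Rt' !mul1r !mulr1.
move=> /(point_cross d); rewrite mul1r => r1 /(point_cross d); rewrite mul1r => r2.
have b0 : b != 0.
  apply/eqP => b0; apply: (none P) => //.
  by rewrite EP (_ : point e f 1 0 = R') // Rt' b0 rmorph0 mul0r.
have tF x : t <> iota x.
  move=> tx; apply: (none R) => //; rewrite Eb1 Rt tx; apply/frame_sublineP.
  by exists 1, x; rewrite oner_eq0 rmorph1.
apply: (@quadratic_even_degree F K iota m t (b * (1 - c))
  (c * (a + b) - (1 + a * b)) (a * (1 - c)) cK _ _ tF); first by rewrite mulf_neq0.
apply: (mulfI (mulf_neq0 u0 v0)); rewrite mulr0.
rewrite !(rmorphD, rmorphB, rmorphM, rmorph1) /=.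
have r1' : u * (1 - t) = v * (t - iota a).
  by apply/eqP; rewrite -subr_eq0; move/eqP: r1; rewrite -subr_eq0;
     congr (_ == 0); ring.
have r2' : u * (1 - iota b * t) = iota c * v * (iota b * t - iota a).
  by apply/eqP; rewrite -subr_eq0; move/eqP: r2; rewrite -subr_eq0;
     congr (_ == 0); ring.
(* Cross-multiplying [r1'] and [r2'] eliminates u and v; the difference is u v times the quadratic
   polynomial in t. *)
transitivity ((u * (1 - t)) * (iota c * v * (iota b * t - iota a)) -
   (v * (t - iota a)) * (u * (1 - iota b * t))); first by ring.
by rewrite r1' r2' mulrC subrr.
Qed.

(* The sublines pass through 0, oo, 1, a = b * n for the first, 0, oo, t, b * t
   for the second, and 1, a, t, b * t for the third.  The value of a makes the
   relation stating that b * t lies on the third subline proportional to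
   t^2 - s t + n = 0, and d is the coordinate of b * t on it. *)
Lemma triangle_of_quadratic (F K : finFieldType) (iota : {rmorphism F -> K})
    (b s n : F) (t : K) :
    t ^+ 2 = iota s * t - iota n -> (forall x, t <> iota x) ->
    b != 0 -> b != 1 -> b * n != 1 ->
  exists b1 b2 b3 : {set {vspace 'rV[K]_2}},
     (is_subline iota b1 /\ is_subline iota b2 /\ is_subline iota b3) /\
     (b1 <> b2 /\ b1 <> b3 /\ b2 <> b3) /\
     (#|b1 :&: b2| = 2%N /\ #|b1 :&: b3| = 2%N /\ #|b2 :&: b3| = 2%N) /\
     b1 :&: b2 :&: b3 = set0.
Proof.
move=> quad tF b0 b1 bn1.
have tFn x : t != iota x by apply/eqP.
pose a := b * n.
have n0 : n != 0.
  apply: contraTneq (tFn s) => n0; rewrite negbK.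
  have t0 : t != 0 by rewrite -(rmorph0 iota).
  by rewrite -(inj_eq (mulIf t0)) -expr2 quad n0 rmorph0 subr0.
have a0 : a != 0 by rewrite mulf_neq0.
have t0 : t != 0 by rewrite -(rmorph0 iota).
have at0 : iota a - t != 0 by rewrite subr_eq0 eq_sym.
have t10 : t - 1 != 0 by rewrite subr_eq0 -(rmorph1 iota).
have a10 : iota a - 1 != 0 by rewrite subr_eq0 -(rmorph1 iota) (inj_eq (fmorph_inj iota)).
(* This is the value of X^2 - s X + n at 1. If it vanished, the roots would be 1 and n, forcing t
   into F. *)
have N1 : n + 1 - s != 0.
  apply: contraTneq (tFn n) => /eqP; rewrite subr_eq0 => /eqP ns; rewrite negbK.
  rewrite -subr_eq0 -(mulIr_eq0 _ (mulIf t10)); apply/eqP.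
  transitivity (t ^+ 2 - iota (n + 1) * t + iota n); first by rewrite rmorphD rmorph1; ring.
  by rewrite quad ns; ring.
pose D := b * (n + 1 - s).
have D0 : D != 0 by rewrite mulf_neq0.
have iD0 : iota D != 0 by rewrite fmorph_eq0.
(* Solution of d (t - 1) (a - b t) = (a - t) (b t - 1): modulo the quadratic relation the two sides
   become d D t and (b^2 n - b s + 1) t. *)
pose d := (b ^+ 2 * n - b * s + 1) / D.
have dD : iota d * iota D = iota (b ^+ 2 * n - b * s + 1) by rewrite -rmorphM divfK.
have key : (iota a - t) + iota d * (t - 1) * iota a =
           iota b * t * ((iota a - t) + iota d * (t - 1)).
  apply: (mulfI iD0).
  have -> : iota D * (iota a - t + iota d * (t - 1) * iota a) =
    iota D * (iota a - t) + (iota d * iota D) * (t - 1) * iota a by ring.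
  have -> : iota D * (iota b * t * (iota a - t + iota d * (t - 1))) =
    iota b * t * (iota D * (iota a - t) + (iota d * iota D) * (t - 1)) by ring.
  rewrite dD /D /a !(rmorphD, rmorphN, rmorphM, rmorphXn, rmorph1) /=.
  have : t ^+ 2 - (iota s * t - iota n) = 0 by rewrite quad subrr.
  move: (iota b) (iota n) (iota s) => B N S q0.
  apply/eqP; rewrite -subr_eq0; apply/eqP.
  (* The multiplier of t^2 - s t + n is the coefficient of t^2 in the difference of the two
     sides. *)
  rewrite -[RHS](mulr0 (B * (B * (N + 1 - S) - (B ^+ 2 * N - B * S + 1)))) -q0.
  ring.
pose e := row2 1 0 : 'rV[K]_2; pose f := row2 0 1 : 'rV[K]_2.
have d1 : det2 e f != 0 by rewrite /det2 !mxE /= mulr1 mulr0 subr0 oner_eq0.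
have d2 : det2 (1 *: e) (t *: f) != 0 by rewrite det2Z mul1r mulf_neq0.
(* The vectors at 1 and a are scaled so that e3 + f3 = (a - 1) (e + t f), which makes t the unit
   point of the third frame. *)
pose e3 := (iota a - t) *: (1 *: e + 1 *: f).
pose f3 := (t - 1) *: (1 *: e + iota a *: f).
have d3 : det2 e3 f3 != 0 by rewrite det2Z det2_comb !mul1r !mulf_neq0.
pose l1 := frame_subline iota e f; pose l2 := frame_subline iota (1 *: e) (t *: f).
pose l3 := frame_subline iota e3 f3.
have s1 : is_subline iota l1 by apply/is_sublineP; exists e, f.
have s2 : is_subline iota l2 by apply/is_sublineP; exists (1 *: e), (t *: f).
have s3 : is_subline iota l3 by apply/is_sublineP; exists e3, f3.
have in1 x y : (x != 0) || (y != 0) -> point e f (iota x) (iota y) \in l1.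
  by move=> xy; apply/frame_sublineP; exists x, y.
have in2 x y : (x != 0) || (y != 0) -> point e f (iota x) (t * iota y) \in l2.
  by move=> xy; apply/frame_sublineP; exists x, y; split; rewrite // /point !scalerA mulr1 mulrC.
have in3 x y X Y k : (x != 0) || (y != 0) -> k != 0 ->
    iota x * (iota a - t) + iota y * (t - 1) = k * X ->
    iota x * (iota a - t) + iota y * (t - 1) * iota a = k * Y ->
    point e f X Y \in l3.
  move=> xy k0 EX EY; apply/frame_sublineP; exists x, y; split=> //.
  by rewrite point_comb !mulr1 EX EY pointZ.
have P1 : point e f 1 0 \in l1.
  by have := in1 1 0; rewrite rmorph0 rmorph1 oner_eq0; apply.
have P1' : point e f 0 1 \in l1.
  by have := in1 0 1; rewrite rmorph0 rmorph1 oner_eq0 orbT; apply.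
have P2 : point e f 1 0 \in l2.
  by have := in2 1 0; rewrite rmorph0 rmorph1 oner_eq0 mulr0; apply.
have P2' : point e f 0 1 \in l2.
  have := in2 0 1; rewrite rmorph0 rmorph1 oner_eq0 orbT => /(_ isT).
  by rewrite -{1}(mulr0 t) pointZ.
have Q1 : point e f 1 1 \in l1.
  by have := in1 1 1; rewrite rmorph1 oner_eq0; apply.
have Q1' : point e f 1 (iota a) \in l1.
  by have := in1 1 a; rewrite rmorph1 oner_eq0; apply.
have Q3 : point e f 1 1 \in l3.
  by apply: (in3 1 0 1 1 (iota a - t)); rewrite ?oner_eq0 // rmorph1 rmorph0; ring.
have Q3' : point e f 1 (iota a) \in l3.
  by apply: (in3 0 1 1 (iota a) (t - 1)); rewrite ?oner_eq0 ?orbT // rmorph1 rmorph0; ring.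
have R2 : point e f 1 t \in l2.
  by have := in2 1 1; rewrite rmorph1 oner_eq0 mulr1; apply.
have R2' : point e f 1 (iota b * t) \in l2.
  by have := in2 1 b; rewrite rmorph1 oner_eq0 mulrC; apply.
have R3 : point e f 1 t \in l3.
  by apply: (in3 1 1 1 t (iota a - 1)); rewrite ?oner_eq0 // rmorph1; ring.
have R3' : point e f 1 (iota b * t) \in l3.
  apply: (in3 1 d _ _ (iota a - t + iota d * (t - 1))); rewrite ?oner_eq0 ?rmorph1 //.
  (* If the scale factor vanished, subtracting it from [key] would give d (t - 1) (a - 1) = 0, so d
     = 0 and then a = t. *)
  - apply: contra_neq at0 => k0.
    move: key; rewrite k0 mulr0 => key.
    have /eqP : iota d * ((t - 1) * (iota a - 1)) = 0.
      by rewrite -[RHS](subrr 0) -{1}key -k0; ring.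
    rewrite mulf_eq0 (negPf (mulf_neq0 t10 a10)) orbF => /eqP d00.
    by move: k0; rewrite d00 mul0r addr0.
  - by rewrite mul1r mulr1.
  - by rewrite mul1r key mulrC.
have nR1 : point e f 1 t \notin l1.
  by apply/negP => /(affine_point_mem d1) [x]; apply: tF.
have nQ2 : point e f 1 1 \notin l2.
  (* In the second frame the point 1 has coordinate 1 / t, which is not in F. *)
  apply/negP; have -> : point e f 1 1 = point (1 *: e) (t *: f) 1 t^-1.
    by rewrite /point !scalerA mulr1 mulVf.
  move=> /(affine_point_mem d2) [x tx]; apply: (tF x^-1).
  by rewrite fmorphV -tx invrK.
have l12 : l1 != l2 by apply: contraNneq nR1 => ->.
have l13 : l1 != l3 by apply: contraNneq nR1 => ->.
have l23 : l2 != l3 by apply: contraNneq nQ2 => ->.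
have PP : point e f 1 0 != point e f 0 1.
  by rewrite eq_point ?oner_eq0 ?orbT // mul0r mulr1 oner_eq0.
have QQ : point e f 1 1 != point e f 1 (iota a).
  by rewrite eq_point ?oner_eq0 // !mul1r -subr_eq0.
have RR : point e f 1 t != point e f 1 (iota b * t).
  rewrite eq_point ?oner_eq0 // mul1r mulr1 -[X in _ == X]mul1r (inj_eq (mulIf t0)).
  by rewrite -(rmorph1 iota) (inj_eq (fmorph_inj iota)).
have E12 : l1 :&: l2 = [set point e f 1 0; point e f 0 1].
  by apply: (sublineI s1 s2); rewrite // inE ?P1 ?P1'.
have E13 : l1 :&: l3 = [set point e f 1 1; point e f 1 (iota a)].
  by apply: (sublineI s1 s3); rewrite // inE ?Q1 ?Q1'.
have E23 : l2 :&: l3 = [set point e f 1 t; point e f 1 (iota b * t)].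
  by apply: (sublineI s2 s3); rewrite // inE ?R2 ?R2'.
exists l1, l2, l3; split; first by [].
split; first by split; [|split]; apply/eqP.
split; first by rewrite E12 E13 E23 !cards2 PP QQ RR.
(* A common point would be 0 or oo as well as 1 or a, which is impossible since a is nonzero. *)
apply/setP => X; rewrite inE in_set0; apply/negP => /andP [X12 X3].
have : X \in l1 :&: l3 by rewrite inE X3 andbT; case/setIP: X12.
move: X12; rewrite E12 E13 !inE => /orP [] /eqP ->;
  by rewrite !eq_point ?oner_eq0 ?orbT // !(mul0r, mul1r, mulr1) ?[0 == _]eq_sym
     ?oner_eq0 ?fmorph_eq0 ?(negPf a0).
Qed.

Theorem mainTheorem7 (p h q m : nat) (hp : prime p) (hh : (0 < h)%N)
    (hq : q = (p ^ h)%N) (hq2 : q <> 2%N) (hm : (0 < m)%N)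
    (F K : finFieldType) (hF : #|F| = q) (hK : #|K| = (q ^ m)%N)
    (iota : {rmorphism F -> K}) :
  (exists b1 b2 b3 : {set {vspace 'rV[K]_2}},
     (is_subline iota b1 /\ is_subline iota b2 /\ is_subline iota b3) /\
     (b1 <> b2 /\ b1 <> b3 /\ b2 <> b3) /\
     (#|b1 :&: b2| = 2%N /\ #|b1 :&: b3| = 2%N /\ #|b2 :&: b3| = 2%N) /\
     b1 :&: b2 :&: b3 = set0)
  <-> ~~ odd m.
Proof.
rewrite -hF in hK.
split=> [[b1 [b2 [b3 [[s1 [s2 s3]] [_ [[c12 [c13 c23]] E0]]]]]]|m_even].
  exact: (even_of_triangle hK s1 s2 s3).
have F2 : (2 < #|F|)%N.
  by rewrite ltn_neqAle finNzRing_gt1 andbT hF eq_sym; apply/eqP.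
(* As q > 2, some b avoids 0 and 1. Then b != 1 separates t from b t, and b n != 1 separates a from
   1. *)
have [b] : exists b, b \notin [set 0; 1 : F].
  apply/existsP; rewrite -negb_forall; apply: contraL F2 => /forallP all01.
  rewrite -leqNgt -cardsT (leq_trans (subset_leq_card (B := [set 0; 1 : F]) _)) //.
    by apply/subsetP => x _.
  by rewrite cards2 eq_sym oner_eq0.
rewrite !inE negb_or => /andP [b0 b1].
have [t [s [n [quad bn tF]]]] := exists_quadratic_norm iota hK hm m_even F2 b0.
exact: triangle_of_quadratic quad tF b0 b1 bn.
Qed.
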